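(* Let $K$ be a finite simplicial complex, let $f,g:K\to\mathbb{R}$ be admissible functions, and let $p\ge 0$. Then $$\mathrm{dist}_{K,p,2}\big(\mathcal{H}_p(K,f),\mathcal{H}_p(K,g)\big)\;\le\;\frac{\pi}{2}\cdot\left(\|f-g\|_1^{(p)}+\|f-g\|_1^{(p+1)}\right)^{1/2}.$$
   Context: A finite simplicial complex $K$ is a set of (nonempty) subsets of $\{0,\dots,M\}$ for some $M$, closed under passing to (nonempty) subsets; $K^{[p]}$ is the set of its $p$-dimensional simplices. $C_p(K)$ is the real vector space with basis $K^{[p]}$, given the inner product for which $K^{[p]}$ is an orthonormal basis; $\partial_p:C_p(K)\to C_{p-1}(K)$ is the usual boundary map ($\partial_0=0$), $Z_p(K)=\ker\partial_p$, $B_p(K)=\mathrm{Im}\,\partial_{p+1}$. The harmonic homology subspace is $\mathcal{H}_p(K)=Z_p(K)\cap B_p(K)^\perp$. For a sub-complex $K'\subset K$, $C_p(K')\subset C_p(K)$, so $\mathcal{H}_p(K')$ is a subspace of $C_p(K)$. For subspaces $A,B$ of a finite-dimensional real inner product space $V$ with $\dim A=k$, $\dim B=\ell$, $$d_V(A,B)=\left(|k-\ell|\frac{\pi^2}{4}+\sum_{i=1}^{\min\{k,\ell\}}\theta_i^2\right)^{1/2},$$ where $\theta_i$ is the $i$-th principal angle between $A$ and $B$. A function $f:K\to\mathbb{R}$ is admissible if $f(\sigma)<f(\tau)$ whenever $\sigma$ is a proper face of $\tau$. Then $K_{f\le t}=f^{-1}((-\infty,t])$ is a sub-complex of $K$ for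 each $t\in\mathbb{R}$. The harmonic filtration function $\mathcal{H}_p(K,f)$ is the map from $\mathbb{R}$ to the set of subspaces of $C_p(K)$ given by $t\mapsto\mathcal{H}_p(K_{f\le t})$. For piecewise constant maps $F,G$ with finitely many discontinuities from $\mathbb{R}$ to the set of subspaces of $C_p(K)$, and $\ell>0$, $$\mathrm{dist}_{K,p,\ell}(F,G)=\left(\int_{\mathbb{R}}d_{C_p(K)}(F(t),G(t))^\ell\,dt\right)^{1/\ell}.$$ For $h:K\to\mathbb{R}$ and $\ell>0$, $\|h\|_\ell^{(p)}=\left(\sum_{\sigma\in K^{[p]}}|h(\sigma)|^\ell\right)^{1/\ell}$. *)

(* Defs.v *)
From HB Require Import structures.
From mathcomp Require Import all_boot all_order all_algebra.
From mathcomp Require Import all_classical all_reals all_analysis.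

Set Implicit Arguments.
Unset Strict Implicit.
Unset Printing Implicit Defensive.

Import Order.TTheory GRing.Theory Num.Theory.
Local Open Scope ring_scope.

Section PrincipalAngles.
Variables (R : realType) (V : vectType R) (ip : V -> V -> R).
Implicit Types (A B : {vspace V}) (s : seq (V * V)).

Definition unit_pair A B s (ab : V * V) : Prop :=
  [/\ ab.1 \in A, ab.2 \in B, ip ab.1 ab.1 = 1, ip ab.2 ab.2 = 1
    & forall cd, cd \in s -> ip cd.1 ab.1 = 0 /\ ip cd.2 ab.2 = 0].

Definition principal_pair A B s (ab : V * V) : Prop :=
  unit_pair A B s ab /\
  forall ab', unit_pair A B s ab' -> ip ab'.1 ab'.2 <= ip ab.1 ab.2.

(* Principal vectors are chosen greedily.  For an inner product [ip] and
   [n <= minn (\dim A) (\dim B)] a maximising pair exists at each step by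
   compactness, so the default (0, 0) is not used.  The vectors depend on the
   choices made, the resulting angles do not. *)
Fixpoint principal_vectors A B (n : nat) : seq (V * V) :=
  if n is m.+1 then
    let s := principal_vectors A B m in
    rcons s (xget (0, 0) (principal_pair A B s : set (V * V)))
  else [::].

(* Indexed from 0. *)
Definition principal_angle A B (i : nat) : R :=
  let ab := nth (0, 0) (principal_vectors A B i.+1) i in acos (ip ab.1 ab.2).

Definition subspace_dist A B : R :=
  Num.sqrt (`|(\dim A)%:R - (\dim B)%:R| * (pi ^+ 2 / 4)
            + \sum_(i < minn (\dim A) (\dim B)) principal_angle A B i ^+ 2).

End PrincipalAngles.

Definition is_simplicial_complex (M : nat) (K : {set {set 'I_M.+1}}) : Prop :=
  finset.set0 \notin K /\
  forall s t : {set 'I_M.+1},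
    t \in K -> s \subset t -> s != finset.set0 -> s \in K.

Definition psimplices (M : nat) (K : {set {set 'I_M.+1}}) (p : nat) :
    {set {set 'I_M.+1}} :=
  [set s : {set 'I_M.+1} in K | #|s| == p.+1]%SET.

(* All chain spaces live in the common space of (inhomogeneous) chains on
   subsets of {0, ..., M}, so that C_p(L) is literally a subspace of C_p(K) when
   L is a sub-complex of K.  Principal angles are intrinsic to a pair of
   subspaces, so they can be computed in this larger space. *)
Definition chain (R : realType) (M : nat) := {ffun {set 'I_M.+1} -> R^o}.
HB.instance Definition _ (R : realType) (M : nat) := Vector.on (chain R M).

Section Chains.
Variables (R : realType) (M : nat).
Implicit Types (K : {set {set 'I_M.+1}}) (c d : chain R M).

Definition simplex_chain (s : {set 'I_M.+1}) : chain R M :=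
  [ffun t => (t == s)%:R].

(* The standard inner product, for which the simplices are orthonormal. *)
Definition chain_ip c d : R := \sum_s c s * d s.

(* [#|[set w in s | w < v]|] is the position of v in s listed increasingly. *)
Definition boundary_simplex (s : {set 'I_M.+1}) : chain R M :=
  if (#|s| <= 1)%N then 0
  else \sum_(v in s) (-1) ^+ #|[set w : 'I_M.+1 in s | (w < v)%N]%SET|
                      *: simplex_chain (s :\ v)%SET.

Definition boundary c : chain R M := \sum_s c s *: boundary_simplex s.

Fact boundary_is_linear : linear boundary.
Proof.
move=> a c d; rewrite /boundary scaler_sumr -big_split /=.
by apply: eq_bigr => s _; rewrite !ffunE scalerDl scalerA.
Qed.
HB.instance Definition _ :=
  GRing.isLinear.Build R (chain R M) (chain R M) _ boundary boundary_is_linear.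

Definition chain_ipl d c : R^o := chain_ip c d.

Fact chain_ipl_is_linear d : linear (chain_ipl d).
Proof.
move=> a c c'; rewrite /chain_ipl /chain_ip scaler_sumr -big_split /=.
by apply: eq_bigr => s _; rewrite !ffunE mulrDl -[X in X + _]mulrA.
Qed.
HB.instance Definition _ d :=
  GRing.isLinear.Build R (chain R M) R^o _ (chain_ipl d)
    (chain_ipl_is_linear d).

Definition orthov (B : {vspace chain R M}) : {vspace chain R M} :=
  (\bigcap_(b <- vbasis B) lker (linfun (chain_ipl b)))%VS.

Lemma memv_orthov (B : {vspace chain R M}) c :
  (c \in orthov B) <-> (forall b, b \in B -> chain_ip c b = 0).
Proof.
have ipC x y : chain_ip x y = chain_ip y x.
  by apply: eq_bigr => s _; rewrite mulrC.
rewrite /orthov; split=> [Hc b bB|H].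
  rewrite (coord_vbasis bB) ipC.
  rewrite -[LHS]/(chain_ipl c _) linear_sum big1 // => i _.
  rewrite linearZ /= /chain_ipl ipC.
  have : c \in lker (linfun (chain_ipl (vbasis B)`_i)).
    have iB : (vbasis B)`_i \in (vbasis B : seq _).
      by rewrite mem_nth // size_tuple.
    move: Hc; rewrite (big_rem _ iB) /= memv_cap => /andP[] //.
  by rewrite memv_ker lfunE /= /chain_ipl => /eqP ->; rewrite scaler0.
rewrite big_seq; elim/big_ind : _ => [|U W HU HW|b bB].
- exact: memvf.
- by rewrite memv_cap HU.
- by rewrite memv_ker lfunE /= /chain_ipl H // vbasis_mem.
Qed.

Definition chain_space K (p : nat) : {vspace chain R M} :=
  <<[seq simplex_chain s | s <- enum (psimplices K p)]>>%VS.

Definition cycles K (p : nat) : {vspace chain R M} :=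
  (chain_space K p :&: lker (linfun boundary))%VS.

Definition boundaries K (p : nat) : {vspace chain R M} :=
  (linfun boundary @: chain_space K p.+1)%VS.

Definition harmonic K (p : nat) : {vspace chain R M} :=
  (cycles K p :&: orthov (boundaries K p))%VS.

(* Functions on K are total functions on sets of vertices, of which only the
   values on K are used. *)
Definition is_admissible K (f : {set 'I_M.+1} -> R) : Prop :=
  forall s t : {set 'I_M.+1},
    s \in K -> t \in K -> s \proper t -> f s < f t.

Definition sublevel K (f : {set 'I_M.+1} -> R) (t : R) :
    {set {set 'I_M.+1}} :=
  [set s : {set 'I_M.+1} in K | f s <= t]%SET.

Definition harmonic_filtration K (p : nat) (f : {set 'I_M.+1} -> R) :
    R -> {vspace chain R M} :=
  fun t => harmonic (sublevel K f t) p.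

Definition filtration_dist (l : R) (F G : R -> {vspace chain R M}) : \bar R :=
  poweR (\int[@lebesgue_measure R]_t
          (subspace_dist chain_ip (F t) (G t) `^ l)%:E)%E l^-1.

Definition simplex_norm K (p : nat) (l : R) (h : {set 'I_M.+1} -> R) : R :=
  (\sum_(s in psimplices K p) `|h s| `^ l) `^ l^-1.

End Chains.

(* Main.v *)
From HB Require Import structures.
Require Import Defs.
From mathcomp Require Import all_boot all_order all_algebra.
From mathcomp Require Import all_classical all_reals all_analysis.
From mathcomp Require Import measurable_realfun.
From mathcomp Require Import ring lra.

(** The inequality is the integral over t of a pointwise one: writing A and B
for the harmonic spaces of the two sublevel complexes at time t,

  d(A, B)^2 <= pi^2/4 * #{s of dimension p or p+1 in exactly one of them}.

The set of times at which a simplex s lies in exactly one of the sublevel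
complexes is the half-open interval between f s and g s, of length |f s - g s|,
so integrating the right-hand side gives pi^2/4 times the sum of the two
1-norms; the theorem is the square root of this.

The pointwise bound has two halves, linked by the dimension of A :&: B.

- Geometry ([subspace_dist_sqr_le]).  Principal angles lie between 0 and pi/2,
  and the first dim (A :&: B) of them vanish.  At most
  min (dim A, dim B) - dim (A :&: B) angles thus contribute pi^2/4 each, and
  together with the term for the difference of dimensions this gives
  d(A, B)^2 <= pi^2/4 * (max (dim A, dim B) - dim (A :&: B)).

- Linear algebra ([dim_harmonic_le]).  A chain is harmonic for L when it is
  supported on the p-simplices of L, is a cycle, and is orthogonal to the
  boundaries of the (p+1)-simplices of L.  Being a cycle does not depend on L, so
  a chain harmonic for K is also harmonic for L as soon as it satisfies one
  linear equation for each p-simplex of K outside L (vanishing there) and one for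
  each (p+1)-simplex of L outside K (orthogonality to its boundary).  The
  codimension of A :&: B in A is at most the number of these equations, and
  likewise for B. *)

Set Implicit Arguments.
Unset Strict Implicit.
Unset Printing Implicit Defensive.

Import Order.TTheory GRing.Theory Num.Theory.

Local Open Scope ring_scope.

(** * Principal angles *)

(** Each functional cuts the dimension by at most one, its image lying in a
line.  Both halves of the proof count dimensions this way: here to find vectors
orthogonal to those already chosen, later to compare harmonic spaces. *)
Lemma dim_le_common_zeros (F : fieldType) (V : vectType F) (U W : {vspace V})
    (s : seq 'Hom(V, F^o)) :
    (forall v, v \in U -> (forall phi, phi \in s -> phi v = 0) -> v \in W) ->
  (\dim U <= \dim W + size s)%N.
Proof.
elim: s U => [|phi s IHs] U zerosW.
  by rewrite addn0 dimvS //; apply/subvP => v vU; apply: zerosW.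
have dim_img : (\dim (phi @: U) <= 1)%N.
  by apply: leq_trans (dimvS (subvf _)) _; rewrite dimvf.
have/IHs : forall v, v \in (U :&: lker phi)%VS ->
    (forall psi, psi \in s -> psi v = 0) -> v \in W.
  move=> v; rewrite memv_cap memv_ker => /andP[vU /eqP phiv0] sv0.
  apply: zerosW => // psi; rewrite inE => /predU1P[->//|]; exact: sv0.
rewrite -(limg_ker_dim phi U) /= addnS => dimW.
by rewrite -addn1 leq_add.
Qed.

Lemma acos_le_pihalf (R : realType) (x : R) : 0 <= x <= 1 -> 0 <= acos x <= pi / 2.
Proof.
move=> /andP[x0 x1].
have [|acos_itv cosE] := @acos_def _ x; first by rewrite x1 andbT; lra.
have /andP[-> acos_pi] /= := acos_itv; rewrite leNgt; apply/negP => lt_pi2.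
have : cos (acos x) < cos (pi / 2).
  have pi0 := pi_gt0 R.
  by rewrite ltr_cos // in_itv /=; apply/andP; split; lra.
by rewrite cosE cos_pihalf ltNge x0.
Qed.

Definition inner_product (R : realType) (V : vectType R) (ip : V -> V -> R) :=
  [/\ forall x y, ip x y = ip y x,
      forall a x y z, ip (a *: x + y) z = a * ip x z + ip y z
    & forall x, x != 0 -> 0 < ip x x].

Section PrincipalAngleBounds.
Variables (R : realType) (V : vectType R) (ip : V -> V -> R).
Hypothesis ipP : inner_product ip.
Implicit Types (A B : {vspace V}) (s : seq (V * V)).

Let ipC x y : ip x y = ip y x. Proof. by case: ipP. Qed.

Let ip_linear a x y z : ip (a *: x + y) z = a * ip x z + ip y z.
Proof. by case: ipP. Qed.

Let ip_gt0 x : x != 0 -> 0 < ip x x. Proof. by case: ipP => _ _; apply. Qed.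

Let ip0l y : ip 0 y = 0.
Proof. by have := ip_linear 1 0 0 y; rewrite scaler0 addr0; lra. Qed.

Let ipZl a x y : ip (a *: x) y = a * ip x y.
Proof. by rewrite -[a *: x]addr0 ip_linear ip0l addr0. Qed.

Let ip_ge0 x : 0 <= ip x x.
Proof. by have [->|/ip_gt0/ltW//] := eqVneq x 0; rewrite ip0l. Qed.

(** For unit vectors this identity turns positivity of the inner product into
the Cauchy-Schwarz inequality together with its equality case. *)
Lemma ip_sub_unit x y : ip x x = 1 -> ip y y = 1 ->
  ip (x - y) (x - y) = 2 * (1 - ip x y).
Proof.
move=> x1 y1; rewrite -scaleN1r addrC ip_linear ipC ip_linear.
rewrite [ip x (_ + _)]ipC ip_linear x1 y1 (ipC y x); ring.
Qed.

Lemma ip_unit_le1 x y : ip x x = 1 -> ip y y = 1 -> ip x y <= 1.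
Proof.
by move=> x1 y1; have := ip_ge0 (x - y); rewrite ip_sub_unit //; lra.
Qed.

Lemma ip_unit_eq1 x y : ip x x = 1 -> ip y y = 1 -> ip x y = 1 -> x = y.
Proof.
move=> x1 y1 xy1; apply/eqP; rewrite -subr_eq0; apply: contraT => /ip_gt0.
by rewrite ip_sub_unit // xy1 subrr mulr0 ltxx.
Qed.

(** The cosine of a principal angle is nonnegative because (- a, b) competes with
(a, b) in the maximisation. *)
Lemma principal_pair_itv A B s ab : principal_pair ip A B s ab ->
  0 <= ip ab.1 ab.2 <= 1.
Proof.
move=> [[aA bB a1 b1 orth] abmax]; rewrite ip_unit_le1 // andbT.
have /abmax /= : unit_pair ip A B s (- ab.1, ab.2).
  split=> //=; first by rewrite rpredN.
    by rewrite -scaleN1r ipZl ipC ipZl a1; ring.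
  move=> cd /orth[c0 d0]; split=> //.
  by rewrite -scaleN1r ipC ipZl ipC c0 mulr0.
by rewrite -scaleN1r ipZl; lra.
Qed.

Let ip_functional (y : V) : {phi : 'Hom(V, R^o) | forall x, phi x = ip x y}.
Proof.
pose f (x : V) : R^o := ip x y.
have lin_f : linear f by move=> a x z; rewrite /f ip_linear.
pose F : {linear V -> R^o} := HB.pack f (GRing.isLinear.Build _ _ _ _ f lin_f).
by exists (linfun F) => x; rewrite lfunE.
Qed.

Lemma unit_orthogonal_exists U (s : seq V) : (size s < \dim U)%N ->
  exists2 u, u \in U & ip u u = 1 /\ forall c, c \in s -> ip c u = 0.
Proof.
move=> lt_sU.
have [v [vU v0 orth]] : exists v, [/\ v \in U, v != 0
    & forall c, c \in s -> ip c v = 0].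
  apply: contrapT => none.
  have : (\dim U <= \dim (0 : {vspace V})
                    + size [seq sval (ip_functional c) | c <- s])%N.
    apply: dim_le_common_zeros => v vU sv0; rewrite memv0.
    apply: contraT => v0; exfalso; apply: none; exists v; split=> // c cs.
    by rewrite ipC -(svalP (ip_functional c)) sv0 //; apply: map_f.
  by rewrite dimv0 size_map leqNgt lt_sU.
exists ((Num.sqrt (ip v v))^-1 *: v); first exact: memvZ.
have sv0 : Num.sqrt (ip v v) != 0 by rewrite sqrtr_eq0 -ltNge ip_gt0.
split=> [|c cs]; last by rewrite ipC ipZl [ip v c]ipC (orth _ cs) mulr0.
rewrite ipZl ipC ipZl -{3}(sqr_sqrtr (ip_ge0 v)); field; exact: sv0.
Qed.

(** As long as the earlier pairs are diagonal and fewer than dim (A :&: B), some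
unit vector u of A :&: B is orthogonal to all of them.  The pair (u, u) reaches
the largest possible inner product 1, so a maximising pair exists, every such
pair also reaches 1, and equality in the Cauchy-Schwarz inequality makes it
diagonal. *)
Lemma principal_pair_common A B s ab :
    {in s, forall cd, cd.1 = cd.2} -> (size s < \dim (A :&: B)%VS)%N ->
    ab = xget (0, 0) (principal_pair ip A B s : set (V * V)) ->
  ab.1 = ab.2 /\ ip ab.1 ab.2 = 1.
Proof.
move=> diag_s lt_s abE.
have [u] : exists2 u, u \in (A :&: B)%VS
    & ip u u = 1 /\ forall c, c \in [seq cd.1 | cd <- s] -> ip c u = 0.
  by apply: unit_orthogonal_exists; rewrite size_map.
rewrite memv_cap => /andP[uA uB] [u1 orth].
have uu : unit_pair ip A B s (u, u).
  split=> //= cd cds; rewrite -(diag_s _ cds).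
  by rewrite orth //; apply: (map_f fst).
have [[_ _ a1 b1 _] abmax] : principal_pair ip A B s ab.
  rewrite abE; apply: xgetPex; exists (u, u); split=> // -[a b] [_ _ a1 b1 _].
  by rewrite /= u1 ip_unit_le1.
have ab1 : ip ab.1 ab.2 = 1.
  apply/eqP; rewrite eq_le ip_unit_le1 //=.
  by have /= := abmax _ uu; rewrite u1.
by split=> //; apply: ip_unit_eq1.
Qed.

Lemma size_principal_vectors A B n : size (principal_vectors ip A B n) = n.
Proof. by elim: n => //= n IHn; rewrite size_rcons IHn. Qed.

Lemma principal_angleE A B i :
  principal_angle ip A B i =
  let ab := xget (0, 0) (principal_pair ip A B (principal_vectors ip A B i)
                         : set (V * V)) in acos (ip ab.1 ab.2).
Proof.
by rewrite /principal_angle /= nth_rcons size_principal_vectors ltnn eqxx.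
Qed.

Lemma principal_vectors_diag A B n : (n <= \dim (A :&: B)%VS)%N ->
  {in principal_vectors ip A B n, forall cd, cd.1 = cd.2}.
Proof.
elim: n => // n IHn lt_n cd /=; rewrite mem_rcons inE => /predU1P[cdE|].
  apply: (proj1 (principal_pair_common (IHn (ltnW lt_n)) _ cdE)).
  by rewrite size_principal_vectors.
exact: IHn (ltnW lt_n) _.
Qed.

Lemma principal_angle_common A B i : (i < \dim (A :&: B)%VS)%N ->
  principal_angle ip A B i = 0.
Proof.
move=> lt_i; rewrite principal_angleE /=.
have diag := principal_vectors_diag (ltnW lt_i).
rewrite -(size_principal_vectors A B i) in lt_i.
by have [_ ->] := principal_pair_common diag lt_i (erefl _); apply: acos1.
Qed.

(** Should no maximising pair exist, the default pair (0, 0) has angle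
acos 0 = pi/2, which satisfies the bound as well. *)
Lemma principal_angle_itv A B i : 0 <= principal_angle ip A B i <= pi / 2.
Proof.
rewrite principal_angleE /=; case: xgetP => [ab _ /principal_pair_itv|_] /=.
  exact: acos_le_pihalf.
by rewrite ip0l acos_le_pihalf // lexx ler01.
Qed.

(** The first dim (A :&: B) angles vanish and the others are at most pi/2; then
(max - min) + (min - m) = max - m, where m is dim (A :&: B) and max and min refer
to dim A and dim B. *)
Lemma subspace_dist_sqr_le A B :
  subspace_dist ip A B ^+ 2 <=
  pi ^+ 2 / 4 * (maxn (\dim A) (\dim B) - \dim (A :&: B)%VS)%:R.
Proof.
set m := \dim (A :&: B)%VS; set k := \dim A; set l := \dim B.
have le_m : (m <= minn k l)%N.
  by rewrite leq_min !dimvS ?capvSl ?capvSr.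
have pi0 : 0 <= pi ^+ 2 / 4 :> R by rewrite divr_ge0 ?sqr_ge0.
have sum_le : \sum_(i < minn k l) principal_angle ip A B i ^+ 2
    <= pi ^+ 2 / 4 * (minn k l - m)%:R.
  rewrite -(big_mkord xpredT (fun i => principal_angle ip A B i ^+ 2)).
  rewrite (big_cat_nat (leq0n m) le_m) //= big_nat big1 => [|i]; last first.
    by move=> lt_i; rewrite principal_angle_common // expr0n.
  rewrite add0r mulr_natr -sumr_const_nat; apply: ler_sum => i _.
  have /andP[a0 api] := principal_angle_itv A B i.
  have -> : pi ^+ 2 / 4 = (pi / 2) ^+ 2 :> R by field.
  by rewrite lerXn2r ?nnegrE ?(le_trans a0 api).
rewrite /subspace_dist sqr_sqrtr; last first.
  apply: addr_ge0; first exact: mulr_ge0.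
  by apply: sumr_ge0 => i _; exact: sqr_ge0.
have -> : `|k%:R - l%:R| = (maxn k l - minn k l)%:R :> R.
  have [lekl|/ltnW lekl] := leqP k l.
    by rewrite distrC ger0_norm ?subr_ge0 ?ler_nat // natrB.
  by rewrite ger0_norm ?subr_ge0 ?ler_nat // natrB.
apply: le_trans (lerD (lexx _) sum_le) _.
rewrite [X in X + _]mulrC -mulrDr -natrD ler_wpM2l // ler_nat.
by rewrite addnBA // subnK // (leq_trans (geq_minl _ _) (leq_maxl _ _)).
Qed.

End PrincipalAngleBounds.

(** * Harmonic chains *)

Section HarmonicChains.
Variables (R : realType) (M : nat).
Implicit Types (K L : {set {set 'I_M.+1}}) (c d : chain R M).

Lemma chain_ip_inner_product : inner_product (@chain_ip R M).
Proof.
split=> [x y|a x y z|x].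
- by apply: eq_bigr => s _; rewrite mulrC.
- rewrite /chain_ip mulr_sumr -big_split /=.
  by apply: eq_bigr => s _; rewrite !ffunE mulrDl mulrA.
- move=> x0; have sq_ge0 s : 0 <= x s * x s by rewrite -expr2 sqr_ge0.
  rewrite lt_def sumr_ge0 // andbT; apply: contra x0 => /eqP ip0.
  apply/eqP/ffunP => s; rewrite ffunE; apply/eqP.
  by rewrite -sqrf_eq0 expr2; apply/eqP/(psumr_eq0P _ ip0).
Qed.

Lemma chain_ipC c d : chain_ip c d = chain_ip d c.
Proof. by have [ipC _ _] := chain_ip_inner_product; apply: ipC. Qed.

Lemma chain_ip_simplex (s : {set 'I_M.+1}) c :
  chain_ip (simplex_chain R s) c = c s.
Proof.
rewrite /chain_ip (bigD1 s) //= big1 ?addr0 => [|t /negPf ts].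
  by rewrite ffunE eqxx mul1r.
by rewrite ffunE ts mul0r.
Qed.

Lemma mem_chain_space K p c :
  (c \in chain_space R K p) <-> (forall s, s \notin psimplices K p -> c s = 0).
Proof.
split=> [cK s sK|c0].
  have sub : (chain_space R K p
              <= lker (linfun (chain_ipl (simplex_chain R s))))%VS.
    apply/span_subvP => d /mapP[t]; rewrite mem_enum => tK {d}->.
    rewrite memv_ker lfunE /= /chain_ipl chain_ipC chain_ip_simplex ffunE.
    by case: (s =P t) sK => [->|]; rewrite ?tK ?eqxx.
  have := subvP sub _ cK.
  by rewrite memv_ker lfunE /= /chain_ipl chain_ipC chain_ip_simplex => /eqP.
have -> : c = \sum_s c s *: simplex_chain R s.
  apply/ffunP => t; rewrite sum_ffunE (bigD1 t) //= big1 ?addr0 => [|s st].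
    by rewrite !ffunE eqxx [_ *: _]mulr1.
  by rewrite !ffunE eq_sym (negPf st) scaler0.
apply: memv_suml => s _; have [sK|sK] := boolP (s \in psimplices K p).
  by rewrite memvZ // memv_span // map_f // mem_enum.
by rewrite c0 // scale0r mem0v.
Qed.

Lemma boundary_simplex_chain (s : {set 'I_M.+1}) :
  boundary (simplex_chain R s) = boundary_simplex R s.
Proof.
rewrite /boundary (bigD1 s) //= big1 ?addr0 => [|t /negPf ts].
  by rewrite ffunE eqxx scale1r.
by rewrite ffunE ts scale0r.
Qed.

(** Harmonicity as a list of linear equations, of which only the first and the
last families depend on K. *)
Lemma mem_harmonic K p c :
  (c \in Defs.harmonic R K p) <->
  [/\ forall s, s \notin psimplices K p -> c s = 0,
      boundary c = 0
    & forall s, s \in psimplices K p.+1 ->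
        chain_ip (boundary_simplex R s) c = 0].
Proof.
rewrite /Defs.harmonic /cycles !memv_cap memv_ker lfunE /=; split.
  move=> /andP[/andP[/mem_chain_space cK /eqP c0] /memv_orthov orth].
  split=> // s sK; rewrite chain_ipC orth // -boundary_simplex_chain.
  rewrite -[boundary _](lfunE (@boundary R M)).
  by rewrite memv_img // memv_span // map_f // mem_enum.
move=> [/mem_chain_space -> /eqP -> orth] /=; apply/memv_orthov => b.
move=> /memv_imgP[d dK ->]; rewrite lfunE /= chain_ipC /boundary.
rewrite -[LHS]/(chain_ipl c _) linear_sum big1 // => s _.
rewrite linearZ /= /chain_ipl.
have [sK|sK] := boolP (s \in psimplices K p.+1).
  by rewrite orth // scaler0.
by rewrite (iffLR (mem_chain_space _ _ _) dK) // scale0r.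
Qed.

(** The functionals [phis] are the equations of [harmonic L p] that elements of
[harmonic K p] do not already satisfy. *)
Lemma dim_harmonic_le K L p :
  (\dim (Defs.harmonic R K p) <=
   \dim (Defs.harmonic R K p :&: Defs.harmonic R L p)%VS
   + (#|psimplices K p :\: psimplices L p|
      + #|psimplices L p.+1 :\: psimplices K p.+1|))%N.
Proof.
pose phis := [seq linfun (chain_ipl (simplex_chain R s))
               | s <- enum (psimplices K p :\: psimplices L p)]
  ++ [seq linfun (chain_ipl (boundary_simplex R s))
       | s <- enum (psimplices L p.+1 :\: psimplices K p.+1)].
have -> : (#|psimplices K p :\: psimplices L p|
      + #|psimplices L p.+1 :\: psimplices K p.+1|)%N = size phis.
  by rewrite size_cat !size_map -!cardE.
apply: dim_le_common_zeros => c cK phi0; rewrite memv_cap cK /=.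
have [cK0 dc0 orthK] := iffLR (mem_harmonic _ _ _) cK.
apply/mem_harmonic; split=> // s.
  move=> sL; have [sK|] := boolP (s \in psimplices K p); last exact: cK0.
  have := phi0 (linfun (chain_ipl (simplex_chain R s))).
  rewrite lfunE /= /chain_ipl chain_ipC chain_ip_simplex; apply.
  rewrite mem_cat; apply/orP; left; apply: map_f.
  by rewrite mem_enum finset.in_setD sL.
move=> sL; have [|sK] := boolP (s \in psimplices K p.+1); first exact: orthK.
have := phi0 (linfun (chain_ipl (boundary_simplex R s))).
rewrite lfunE /= /chain_ipl chain_ipC; apply.
rewrite mem_cat; apply/orP; right; apply: map_f.
by rewrite mem_enum finset.in_setD sK.
Qed.

End HarmonicChains.

(** * Simplices present in exactly one sublevel complex *)

(** The times at which a simplex born at times a and b in two filtrations is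
present in exactly one of them. *)
Definition separating (R : realType) (a b : R) : set R :=
  [set t | (a <= t) != (b <= t)]%classic.

Lemma separatingE (R : realType) (a b : R) :
  separating a b = [set` `[Num.min a b, Num.max a b[%R]%classic.
Proof.
apply/seteqP; split=> t; rewrite /separating /= in_itv /= ge_min lt_max !ltNge;
  by case: (a <= t); case: (b <= t).
Qed.

Lemma measurable_separating (R : realType) (a b : R) :
  measurable (separating a b).
Proof. by rewrite separatingE; exact: measurable_itv. Qed.

Lemma lebesgue_measure_separating (R : realType) (a b : R) :
  lebesgue_measure (separating a b) = `|a - b|%:E.
Proof.
rewrite separatingE lebesgue_measure_itv /= lte_fin.
have [ab|ba|->] := ltgtP a b; last by rewrite ltxx subrr normr0.
  by rewrite ab -EFinB distrC gtr0_norm // subr_gt0.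
by rewrite ba -EFinB gtr0_norm // subr_gt0.
Qed.

Section PointwiseBound.
Variables (R : realType) (M : nat).
Implicit Types (K : {set {set 'I_M.+1}}).

Lemma psimplices_sublevelD K (f g : {set 'I_M.+1} -> R) p t :
  psimplices (sublevel K f t) p :\: psimplices (sublevel K g t) p
  \subset [set s in psimplices K p | (f s <= t) != (g s <= t)]%SET.
Proof.
apply/fintype.subsetP => s; rewrite !inE.
by case: (s \in K); case: (f s <= t); case: (g s <= t); case: (_ == _).
Qed.

Lemma card_changing_simplices K (f g : {set 'I_M.+1} -> R) p t :
  #|[set s in psimplices K p | (f s <= t) != (g s <= t)]%SET|%:R
  = \sum_(s in psimplices K p) \1_(separating (f s) (g s)) t :> R.
Proof.
rewrite -sum1_card natr_sum big_set /= big_mkcondr.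
apply: eq_bigr => s _; rewrite indicE.
have -> : (t \in separating (f s) (g s)) = ((f s <= t) != (g s <= t)).
  by apply/idP/idP; rewrite inE.
by case: ifP.
Qed.

(** The pointwise inequality.  The sum runs over all p- and (p+1)-simplices of K,
so that integrating it in t only takes the measure of [separating]. *)
Lemma harmonic_dist_sqr_le K (f g : {set 'I_M.+1} -> R) p t :
  subspace_dist (@chain_ip R M) (harmonic_filtration K p f t)
                                (harmonic_filtration K p g t) ^+ 2 <=
  \sum_(s <- enum (psimplices K p) ++ enum (psimplices K p.+1))
    pi ^+ 2 / 4 * \1_(separating (f s) (g s)) t.
Proof.
rewrite -mulr_sumr big_cat /= !big_enum /= -!card_changing_simplices.
apply: le_trans (subspace_dist_sqr_le (chain_ip_inner_product R M) _ _) _.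
rewrite ler_wpM2l ?divr_ge0 ?sqr_ge0 // -natrD ler_nat leq_subLR.
have changeC q : [set s in psimplices K q | (f s <= t) != (g s <= t)]%SET
    = [set s in psimplices K q | (g s <= t) != (f s <= t)]%SET.
  by apply: eq_finset => s; rewrite (eq_sym (f s <= t)%R).
rewrite /harmonic_filtration geq_max; apply/andP; split.
  apply: leq_trans (dim_harmonic_le _ _ (sublevel K g t) _) _.
  rewrite leq_add2l leq_add //.
    exact/subset_leq_card/psimplices_sublevelD.
  rewrite changeC; exact/subset_leq_card/psimplices_sublevelD.
rewrite capvC; apply: leq_trans (dim_harmonic_le _ _ (sublevel K f t) _) _.
rewrite leq_add2l leq_add //.
  rewrite changeC; exact/subset_leq_card/psimplices_sublevelD.
exact/subset_leq_card/psimplices_sublevelD.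
Qed.

Lemma simplex_norm1 K p (h : {set 'I_M.+1} -> R) :
  simplex_norm K p 1 h = \sum_(s in psimplices K p) `|h s|.
Proof.
rewrite /simplex_norm invr1 powRr1; last first.
  by apply: sumr_ge0 => *; exact: powR_ge0.
by apply: eq_bigr => s _; rewrite powRr1.
Qed.

End PointwiseBound.

(** * Integration *)

(** The integral of a nonnegative function is the supremum of the integrals of
the simple functions below it, and this supremum is monotone.  Here the smaller
function is the squared distance between the harmonic spaces at each time, whose
behaviour in time thus enters only through the pointwise bound. *)
Lemma le_integral_nonneg d (T : measurableType d) (R : realType)
    (mu : {measure set T -> \bar R}) (f g : T -> \bar R) :
    (forall x, 0 <= f x)%E -> (forall x, f x <= g x)%E ->
  (\int[mu]_x f x <= \int[mu]_x g x)%E.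
Proof.
move=> f0 fg; have g0 x : (0 <= g x)%E := le_trans (f0 x) (fg x).
rewrite !ge0_integralTE //; apply: ereal_sup_le => _ [h hf <-].
by exists h => // x; exact: le_trans (hf x) (fg x).
Qed.

Lemma integral_sum_separating (R : realType) (I : Type) (r : seq I)
    (f g : I -> R) (k : R) : 0 <= k ->
  (\int[@lebesgue_measure R]_t
      (\sum_(i <- r) k * \1_(separating (f i) (g i)) t)%:E
   = (k * \sum_(i <- r) `|f i - g i|)%:E)%E.
Proof.
move=> k0; under eq_integral do rewrite -sumEFin.
have mind i : measurable_fun [set: R]
    (fun t => (\1_(separating (f i) (g i)) t : R)%:E).
  apply/measurable_EFinP; apply: measurable_indic.
  exact: measurable_separating.
rewrite ge0_integral_sum //=.
- rewrite mulr_sumr -sumEFin; apply: eq_bigr => i _.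
  under eq_integral do rewrite EFinM.
  rewrite ge0_integralZl //=; last exact: mind.
  rewrite integral_indic //; last exact: measurable_separating.
  by rewrite setIT [X in (_ * X)%E]lebesgue_measure_separating.
- move=> i; under eq_fun do rewrite EFinM.
  exact: measurable_funeM (mind i).
- by move=> i t _; rewrite lee_fin mulr_ge0.
Qed.

Theorem theorem3p19 (R : realType) (M : nat) (K : {set {set 'I_M.+1}})
    (hK : is_simplicial_complex K) (f g : {set 'I_M.+1} -> R)
    (hf : is_admissible K f) (hg : is_admissible K g) (p : nat) :
  (filtration_dist 2 (harmonic_filtration K p f) (harmonic_filtration K p g)
   <= (pi / 2 * Num.sqrt (simplex_norm K p 1 (fun s => (f s - g s)%R)
                          + simplex_norm K p.+1 1 (fun s => (f s - g s)%R)))%:E)%E.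
Proof.
set N := _ + _.
have N0 : 0 <= N by rewrite addr_ge0 ?powR_ge0.
have pi0 : 0 <= pi / 2 :> R by rewrite divr_ge0 ?pi_ge0.
have -> : pi / 2 * Num.sqrt N = (pi ^+ 2 / 4 * N) `^ 2^-1.
  have -> : pi ^+ 2 / 4 = (pi / 2) ^+ 2 :> R by field.
  rewrite powR12_sqrt; last by rewrite mulr_ge0 ?sqr_ge0.
  by rewrite sqrtrM ?sqr_ge0 // sqrtr_sqr ger0_norm.
have int_le : (\int[@lebesgue_measure R]_t
    (subspace_dist (@chain_ip R M) (harmonic_filtration K p f t)
                   (harmonic_filtration K p g t) `^ 2)%:E
    <= (pi ^+ 2 / 4 * N)%:E)%E.
  rewrite /N !simplex_norm1 -!big_enum /= -big_cat /=.
  rewrite -integral_sum_separating ?divr_ge0 ?sqr_ge0 //.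
  apply: le_integral_nonneg => t; first by rewrite lee_fin powR_ge0.
  by rewrite lee_fin powR_mulrn ?sqrtr_ge0 // harmonic_dist_sqr_le.
rewrite /filtration_dist -poweR_EFin; apply: gt0_ler_poweR => //.
- rewrite in_itv /= leey andbT integral_ge0 // => t _.
  by rewrite lee_fin powR_ge0.
- by rewrite in_itv /= leey andbT lee_fin mulr_ge0 ?divr_ge0 ?sqr_ge0.
Qed.
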